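(* Let $f\colon\mathcal{E}\to\overline{\mathbb{R}}_{++}$ be any upper semicontinuous, concave function with $R(f)>0$ and $p^*=\sup f\in\mathbb{R}_{++}$ attained at $x^*\in\mathcal{E}$. Fix the stepsizes $\alpha_k=(f^\Gamma(y_k)-d^* )/\|\zeta_k'\|^2$, where $d^*=\inf f^\Gamma$. If $f$ satisfies, for some $C>0$, the sharp growth condition $$f(x)\le\left(f(x^* )-C\|x-x^*\|\right)_+\qquad\text{for all }x\in\mathcal{E},$$ then the radial subgradient method has $x_k=y_k/f^\Gamma(y_k)$ satisfying, for any $\epsilon>0$, $$T\ge4\left(\frac{p^*+C\|x^*\|}{C\,R(f)}\right)^2\log_2\!\left(\frac{p^*-f(x_0)}{f(x_0)\,\epsilon}\right)\quad\Longrightarrow\quad\min_{k<T}\left\{\frac{p^*-f(x_k)}{f(x_k)}\right\}\le\epsilon.$$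
   Context: $\mathcal{E}$ is a finite-dimensional Euclidean space with norm $\|\cdot\|$, $\overline{\mathbb{R}}_{++}=\mathbb{R}_{++}\cup\{0,+\infty\}$, and $(t)_+=\max\{t,0\}$. For $f\colon\mathcal{E}\to\overline{\mathbb{R}}_{++}$: $\mathrm{dom}\,f=\{x: f(x)\in\mathbb{R}_{++}\}$, $\mathrm{epi}\,f=\{(x,u)\in\mathcal{E}\times\mathbb{R}_{++}: f(x)\le u\}$, $\mathrm{hypo}\,f=\{(x,u)\in\mathcal{E}\times\mathbb{R}_{++}: f(x)\ge u\}$; $f$ is upper semicontinuous if $\mathrm{hypo}\,f$ is closed with respect to $\mathcal{E}\times\mathbb{R}_{++}$, and concave if $\mathrm{hypo}\,f$ is convex. With $\Gamma(x,u)=(x,1)/u$, the radial dual is $f^\Gamma(y)=\sup\{v>0: (y,v)\in\Gamma(\mathrm{epi}\,f)\}=\sup\{v>0: v\cdot f(y/v)\le 1\}$, with $\sup\emptyset=0$. Proximal normals of $S\subseteq\mathcal{E}\times\mathbb{R}$ at $(x,u)\in S$: $N^P_S((x,u))=\{(\zeta,\delta): (x,u)\text{ is a nearest point of }S\text{ to }(x,u)+\epsilon(\zeta,\delta)\text{ for some }\epsilon>0\}$. Proximal subdifferential: $\partial_P g(y)=\{\zeta:(\zeta,-1)\in N^P_{\mathrm{epi}\,g}((y,g(y)))\}$. $R(f)=\inf\{\|x'\| : (x,u)\in\mathrm{hypo}\,f,\ 0\ne(\zeta,\delta)\in N^P_{\mathrm{hypo}\,f}((x,u)),\ x'\in\mathcal{E},\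 (\zeta,\delta)^T((x',0)-(x,u))=0\}$. Radial subgradient method, run for $T$ steps: given $x_0\in\mathrm{dom}\,f$ and stepsizes $\alpha_k$, set $(y_0,v_0)=\Gamma(x_0,f(x_0))$, i.e. $y_0=x_0/f(x_0)$, and for $k=0,1,\dots,T-1$ set $y_{k+1}=y_k-\alpha_k\zeta_k'$ where $\zeta_k'\in\partial_P f^\Gamma(y_k)$.
   Formalization: Adds T>0 and, when ε<(p*−f(x_0))/f(x_0), T≥2((p*+C‖x*‖)/(C R(f)))². As printed the claim fails, e.g. f=(1−|x|)_+, x_0=1/2, ε=2^(−1/4), T=1. The second condition follows from the printed bound once ε≤(p*−f(x_0))/(√2 f(x_0)). *)

(* Defs.v *)
From mathcomp Require Import all_boot all_order all_algebra.
From mathcomp Require Import all_classical all_reals all_analysis.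
Set Implicit Arguments.
Unset Strict Implicit.
Unset Printing Implicit Defensive.
Import Order.TTheory GRing.Theory Num.Theory.
Import numFieldNormedType.Exports.
Local Open Scope classical_set_scope.
Local Open Scope ring_scope.

(* The Euclidean space is R^n = 'rV[R]_n with its standard inner product.  The
   library's norm on matrices is the sup norm, hence norm2 below; the two
   induce the same topology, so the library's [closed] is used as it is. *)
Definition dotp (R : realType) (n : nat) (x y : 'rV[R]_n) : R :=
  \sum_(i < n) x ord0 i * y ord0 i.

Definition norm2 (R : realType) (n : nat) (x : 'rV[R]_n) : R :=
  Num.sqrt (dotp x x).

(* R^n x R; R^o is R seen as a module over itself, which makes the pair an
   lmodType. *)
Notation ER R n := ('rV[R]_n * R^o)%type.

Definition dotER (R : realType) (n : nat) (a b : ER R n) : R :=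
  dotp a.1 b.1 + a.2 * b.2.

Definition normER (R : realType) (n : nat) (a : ER R n) : R :=
  Num.sqrt (dotER a a).

(* A function with values in {0} U ]0, +oo[ U {+oo} is a function with values
   in \bar R together with the hypothesis that it is nonnegative. *)
Definition dom (R : realType) (n : nat) (f : 'rV[R]_n -> \bar R) :
    set 'rV[R]_n :=
  [set x | (0 < f x < +oo)%E].

Definition epi (R : realType) (n : nat) (f : 'rV[R]_n -> \bar R) :
    set (ER R n) :=
  [set a | 0 < a.2 /\ (f a.1 <= a.2%:E)%E].

Definition hypo (R : realType) (n : nat) (f : 'rV[R]_n -> \bar R) :
    set (ER R n) :=
  [set a | 0 < a.2 /\ (a.2%:E <= f a.1)%E].

Definition upper_semicont (R : realType) (n : nat) (f : 'rV[R]_n -> \bar R) :=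
  closed (hypo f : set (subspace [set a : ER R n | 0 < a.2])).

Definition concave (R : realType) (n : nat) (f : 'rV[R]_n -> \bar R) :=
  convex_set (hypo f : set (convex_lmodType (ER R n))).

Definition Gam (R : realType) (n : nat) (a : ER R n) : ER R n :=
  (a.2^-1 *: a.1, a.2^-1).

(* The element 0 in the set encodes sup set0 = 0 (ereal_sup set0 is -oo); it
   does not change the supremum otherwise. *)
Definition radial_dual (R : realType) (n : nat) (f : 'rV[R]_n -> \bar R)
    (y : 'rV[R]_n) : \bar R :=
  ereal_sup (0%E |` [set v%:E | v in
    [set v : R | 0 < v /\ (@Gam R n @` epi f) (y, v)]]).

Definition nearest_point (R : realType) (n : nat) (S : set (ER R n))
    (q a : ER R n) :=
  S a /\ forall b, S b -> normER (q - a) <= normER (q - b).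

Definition prox_normal (R : realType) (n : nat) (S : set (ER R n))
    (a : ER R n) : set (ER R n) :=
  [set w | exists2 e : R, 0 < e & nearest_point S (a + e *: w) a].

(* If g y is 0 or +oo then (y, fine (g y)) is not in epi g and the
   subdifferential is empty. *)
Definition prox_subdiff (R : realType) (n : nat) (g : 'rV[R]_n -> \bar R)
    (y : 'rV[R]_n) : set 'rV[R]_n :=
  [set z | prox_normal (epi g) (y, fine (g y)) (z, -1)].

Definition Rf (R : realType) (n : nat) (f : 'rV[R]_n -> \bar R) : \bar R :=
  ereal_inf [set (norm2 x')%:E | x' in
    [set x' : 'rV[R]_n | exists a w : ER R n,
      [/\ hypo f a, w != 0, prox_normal (hypo f) a w &
          dotER w ((x', 0) - a) = 0]]].

Definition radial_subgradient_method (R : realType) (n : nat)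
    (f : 'rV[R]_n -> \bar R) (T : nat) (x0 : 'rV[R]_n) (alpha : nat -> R)
    (y zeta : nat -> 'rV[R]_n) :=
  [/\ dom f x0, y 0%N = (Gam (x0, fine (f x0))).1 &
      forall k, (k < T)%N ->
        prox_subdiff (radial_dual f) (y k) (zeta k) /\
        y k.+1 = y k - alpha k *: zeta k].

(* fine only turns finite values into reals: a point with a proximal
   subgradient has a finite f^Gamma, and then 0 <= inf f^Gamma < +oo.  If the
   subgradient is 0 then so is the quotient, and the step does not move. *)
Definition polyak_step (R : realType) (n : nat) (f : 'rV[R]_n -> \bar R)
    (y z : 'rV[R]_n) : R :=
  (fine (radial_dual f y) - fine (ereal_inf (range (radial_dual f))))
    / norm2 z ^+ 2.

Definition primal_point (R : realType) (n : nat) (f : 'rV[R]_n -> \bar R)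
    (y : 'rV[R]_n) : 'rV[R]_n :=
  (fine (radial_dual f y))^-1 *: y.

(* Extended-real quotient: the gap is +oo where f vanishes and p > 0. *)
Definition rel_gap (R : realType) (n : nat) (f : 'rV[R]_n -> \bar R) (p : R)
    (x : 'rV[R]_n) : \bar R :=
  ((p%:E - f x) / f x)%E.

(* lne 0 = -oo, so this is log_2 with log_2 0 = -oo. *)
Definition log2e (R : realType) (t : \bar R) : \bar R :=
  (lne t / (ln 2)%:E)%E.

(* Extended-real quotient: r may be +oo (when n = 0), and then kappa is 0. *)
Definition kappa (R : realType) (n : nat) (p C : R) (xs : 'rV[R]_n)
    (r : \bar R) : \bar R :=
  ((p + C * norm2 xs)%:E / (C%:E * r))%E.

(* Main.v *)
(* A positive radius R(f) forces f(0) > 0: otherwise, for each rho > 0, the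
   cone |x| + rho <= m u with the least m for which it meets hypo f touches it
   at a point with x <> 0, and the tangent hyperplane there cuts u = 0 at
   distance rho from the origin.  Once f(0) > 0, Gamma maps hypo f
   onto epi f^Gamma, so f^Gamma is convex, and a subgradient zeta of f^Gamma is
   pulled back to a supporting hyperplane of hypo f at distance 1/|zeta| from
   the origin; hence |zeta| <= 1/R(f).  With y* = x*/p, sharp growth of f
   becomes C |y - y*| <= (p + C|x*|) (f^Gamma(y) - 1/p), and the usual analysis
   of Polyak steps applies.  Finally (p - f(x_k)) / f(x_k) is at most
   p f^Gamma(y_k) - 1. *)

Require Import Defs.
From mathcomp Require Import all_boot all_order all_algebra.
From mathcomp Require Import all_classical all_reals all_analysis.
From mathcomp Require Import ring lra.
Set Implicit Arguments.
Unset Strict Implicit.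
Unset Printing Implicit Defensive.
Import Order.TTheory GRing.Theory Num.Theory.
Import numFieldNormedType.Exports.
Local Open Scope classical_set_scope.
Local Open Scope ring_scope.

(** * The scalar recursion behind Polyak steps *)

(* [D] is a squared distance.  It shrinks by [1 - 1/kap^2] at each step; apply
   this to the first half of the run, and sum the decreases [delta k ^+ 2] over
   the second half. *)
Lemma polyak_iterations (R : realType) (T : nat) (D delta : nat -> R)
    (kap G e : R) :
  (0 < T)%N -> 0 < e -> 1 < G ->
  (forall k, 0 <= D k) ->
  (forall k, (k < T)%N -> 0 <= delta k) ->
  (forall k, (k < T)%N -> D k.+1 <= D k - delta k ^+ 2) ->
  (forall k, (k < T)%N -> D k <= kap ^+ 2 * delta k ^+ 2) ->
  delta 0%N <= G * e ->
  2 * kap ^+ 2 <= T%:R ->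
  4 * kap ^+ 2 * (ln G / ln 2) <= T%:R ->
  exists2 k, (k < T)%N & delta k <= e.
Proof.
move=> T0 e0 G1 D0 delta0 Dstep Dkap dG T2 T4.
apply: contrapT => nle.
have de k : (k < T)%N -> e < delta k.
  by move=> kT; rewrite ltNge; apply/negP => ?; apply: nle; exists k.
pose K := kap ^+ 2.
(* [0 <= D 1 <= D 0 - delta 0 ^+ 2 <= (K - 1) * delta 0 ^+ 2], with [delta 0 > 0]. *)
have K1 : 1 <= K.
  have d0 : 0 < delta 0%N ^+ 2 by rewrite exprn_gt0// (lt_trans e0)// de.
  rewrite -(ler_pM2r d0) mul1r (le_trans _ (Dkap 0%N T0))//.
  by have := Dstep 0%N T0; have := D0 1%N; lra.
have Kp : 0 < K by lra.
pose q := 1 - K^-1.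
have Kv1 : K^-1 <= 1 by rewrite invf_le1.
have q0 : 0 <= q by rewrite subr_ge0.
have Kq : K * q = K - 1 by rewrite mulrBr mulr1 divff// gt_eqF.
have Dq k : (k < T)%N -> D k.+1 <= q * D k.
  move=> kT; apply: le_trans (Dstep k kT) _.
  rewrite mulrBl mul1r lerD2l lerN2 ler_pdivrMl//; exact: Dkap.
have Dqk k : (k <= T)%N -> D k <= q ^+ k * D 0%N.
  elim: k => [|k IH] kT; first by rewrite mul1r.
  apply: le_trans (Dq k kT) _; rewrite exprS -mulrA ler_wpM2l//.
  by apply: IH; exact: ltnW.
(* Each of the [m.+1] steps from [k] on lowers [D] by more than [e ^+ 2], and [D] stays
   nonnegative. *)
have Dsum k m : (k + m.+1 <= T)%N -> m.+1%:R * e ^+ 2 < D k.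
  elim: m k => [|m IH] k kT.
    move: kT; rewrite addn1 => kT.
    have := Dstep k kT; have := D0 k.+1.
    have : e ^+ 2 < delta k ^+ 2.
      by rewrite ltr_pXn2r// ?nnegrE ?(ltW e0) ?delta0// de.
    by rewrite mul1r; lra.
  have kT' : (k < T)%N by rewrite (leq_trans _ kT)// addnS ltnS leq_addr.
  have := IH k.+1; rewrite addSnnS => /(_ kT).
  have := Dstep k kT'.
  have : e ^+ 2 <= delta k ^+ 2.
    by rewrite ler_pXn2r// ?nnegrE ?(ltW e0) ?delta0// ltW// de.
  rewrite -(natr1 m.+1) mulrDl mul1r; lra.
have D0G : D 0%N <= K * (G ^+ 2 * e ^+ 2).
  apply: le_trans (Dkap 0%N T0) _; rewrite ler_pM2l// -exprMn.
  by rewrite ler_pXn2r// ?nnegrE ?delta0// mulr_ge0 ?(ltW e0)//; lra.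
(* [q <= expR (- K^-1)], and [ln 2 <= 1] turns the bound [T4] into [4 * ln G <= T / K]. *)
have qexp : q ^+ T * G ^+ 4 <= 1.
  have ln2_gt0 : 0 < ln (2 : R) by rewrite ln_gt0// ltr1n.
  have ln2_le1 : ln (2 : R) <= 1.
    by have := @le_ln1Dx R 1 ltac:(lra).
  have lnG : 0 < ln G by rewrite ln_gt0.
  have qe : q <= expR (- K^-1) by exact: expR_ge1Dx.
  have G0 : 0 < G by lra.
  have G4 : G ^+ 4 = expR (4 * ln G) by rewrite expRM_natl lnK// posrE.
  have qT : q ^+ T <= expR (T%:R * - K^-1).
    by rewrite expRM_natl ler_pXn2r// nnegrE expR_ge0.
  rewrite G4; apply: le_trans (ler_wpM2r (expR_ge0 _) qT) _.
  rewrite -expRD -[leRHS]expR0 ler_expR mulrN addrC subr_le0 ler_pdivlMr//.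
  apply: le_trans T4; rewrite -/K mulrAC mulrA ler_pdivlMr//.
  have K4 : 0 < 4 * K * ln G by rewrite pmulr_rgt0// pmulr_rgt0// ltr0n.
  by rewrite ger_pMr.
pose k := uphalf T; pose m := T./2.
have kmT : (k + m)%N = T.
  by rewrite /k /m uphalf_half -addnA addnn odd_double_half.
have mE : T%:R = (odd T)%:R + 2 * m%:R :> R.
  by rewrite -natrM -natrD -[in LHS](odd_double_half T) mul2n.
have m0 : (0 < m)%N.
  rewrite lt0n; apply/eqP => m0; move: T2; rewrite mE m0 mulr0 addr0 -/K.
  by case: (odd T) => /=; lra.
have mlt : m%:R < K * q ^+ k * G ^+ 2.
  have e2 : 0 < e ^+ 2 by rewrite exprn_gt0.
  rewrite -(ltr_pM2r e2) -(prednK m0).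
  apply: lt_le_trans (Dsum k m.-1 _) _; first by rewrite prednK ?kmT.
  apply: le_trans (Dqk k _) _; first by rewrite -kmT leq_addr.
  apply: le_trans (ler_wpM2l (exprn_ge0 _ q0) D0G) _.
  by rewrite mulrCA !mulrA.
(* As [2 * k = T + odd T], squaring [mlt] brings out [q ^+ T * G ^+ 4], at most 1 by [qexp]. *)
have m2lt : m%:R ^+ 2 < K ^+ 2 * q ^+ odd T.
  apply: (@lt_le_trans _ _ ((K * q ^+ k * G ^+ 2) ^+ 2)).
    by rewrite ltr_pXn2r// nnegrE ?ler0n// (le_trans _ (ltW mlt)) ?ler0n.
  have kk : (k * 2)%N = (odd T + T)%N.
    rewrite /k uphalf_half muln2 doubleD -[(odd T).*2]addnn -addnA.
    by rewrite odd_double_half.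
  have -> : (K * q ^+ k * G ^+ 2) ^+ 2 = K ^+ 2 * q ^+ odd T * (q ^+ T * G ^+ 4).
    by rewrite !exprMn -!exprM kk exprD; ring.
  rewrite ler_piMr//; apply: mulr_ge0; last exact: exprn_ge0.
  exact: sqr_ge0.
(* If [T] is even, [2 * K <= T] gives [K <= m], against [m ^+ 2 < K ^+ 2]. If [T] is odd, it gives
   [K - 1/2 <= m], against [m ^+ 2 < K ^+ 2 * q = K * (K - 1) < (K - 1/2) ^+ 2]. *)
move: T2 m2lt; rewrite mE -/K.
have : 1 <= m%:R :> R by rewrite ler1n.
move: (m%:R : R) => M M1; case: (odd T) => /= KM.
  have : (K - 2^-1) ^+ 2 <= M ^+ 2 by rewrite ler_pXn2r// ?nnegrE; lra.
  rewrite expr1; have -> : K ^+ 2 * q = K * (K - 1) by rewrite -Kq; ring.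
  lra.
have : K ^+ 2 <= M ^+ 2 by rewrite ler_pXn2r// ?nnegrE; lra.
by rewrite mulr1; lra.
Qed.

(** * Inner products on R^n and R^n x R, and proximal normals *)

Section InnerProduct.
Context {R : realType} {n : nat}.
Implicit Types (x y z : 'rV[R]_n) (a b c w : ER R n) (k : R).

Lemma dotpC x y : dotp x y = dotp y x.
Proof. by apply: eq_bigr => i _; rewrite mulrC. Qed.

Lemma dotpDl x y z : dotp (x + y) z = dotp x z + dotp y z.
Proof. by rewrite -big_split; apply: eq_bigr => i _; rewrite mxE mulrDl. Qed.

Lemma dotpZl k x y : dotp (k *: x) y = k * dotp x y.
Proof. by rewrite mulr_sumr; apply: eq_bigr => i _; rewrite mxE mulrA. Qed.

Lemma dotpNl x y : dotp (- x) y = - dotp x y.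
Proof. by rewrite -scaleN1r dotpZl mulN1r. Qed.

Lemma dotpDr x y z : dotp x (y + z) = dotp x y + dotp x z.
Proof. by rewrite dotpC dotpDl !(dotpC x). Qed.

Lemma dotpZr k x y : dotp x (k *: y) = k * dotp x y.
Proof. by rewrite dotpC dotpZl dotpC. Qed.

Lemma dotpNr x y : dotp x (- y) = - dotp x y.
Proof. by rewrite dotpC dotpNl dotpC. Qed.

Definition dotpE := (dotpDl, dotpDr, dotpNl, dotpNr, dotpZl, dotpZr).

Lemma sqr_dotpD x y k :
  dotp (x + k *: y) (x + k *: y) = dotp x x + 2 * k * dotp x y + k ^+ 2 * dotp y y.
Proof. by rewrite !dotpE (dotpC y); ring. Qed.

Lemma dotp_ge0 x : 0 <= dotp x x.
Proof. by apply: sumr_ge0 => i _; rewrite -expr2 sqr_ge0. Qed.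

Lemma dotp_eq0 x : (dotp x x == 0) = (x == 0).
Proof.
apply/eqP/eqP => [/eqP|->]; last first.
  by apply: big1 => i _; rewrite mxE mul0r.
rewrite psumr_eq0 => [/allP x0|i _]; last by rewrite -expr2 sqr_ge0.
apply/rowP => i; rewrite mxE; apply/eqP.
by have := x0 i (mem_index_enum _); rewrite -expr2 sqrf_eq0.
Qed.

Lemma norm2_ge0 x : 0 <= norm2 x.
Proof. exact: sqrtr_ge0. Qed.

Lemma sqr_norm2 x : norm2 x ^+ 2 = dotp x x.
Proof. exact/sqr_sqrtr/dotp_ge0. Qed.

Lemma norm2_eq0 x : (norm2 x == 0) = (x == 0).
Proof. by rewrite -dotp_eq0 -sqr_norm2 sqrf_eq0. Qed.

Lemma norm2_gt0 x : (0 < norm2 x) = (x != 0).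
Proof. by rewrite lt_def norm2_eq0 norm2_ge0 andbT. Qed.

Lemma norm2Z k x : norm2 (k *: x) = `|k| * norm2 x.
Proof. by rewrite /norm2 !dotpE mulrA -expr2 sqrtrM ?sqr_ge0// sqrtr_sqr. Qed.

Lemma norm_coord_le x i : `|x ord0 i| <= norm2 x.
Proof.
rewrite -(@ler_pXn2r _ 2)// ?nnegrE ?norm2_ge0// sqr_norm2 real_normK ?num_real//.
rewrite /dotp (bigD1 i)//= -expr2 lerDl.
by apply: sumr_ge0 => j _; rewrite -expr2 sqr_ge0.
Qed.

Lemma dotERBr w a b : dotER w (a - b) = dotER w a - dotER w b.
Proof. by rewrite /dotER /= dotpDr dotpNr; ring. Qed.

Lemma sqr_dotERD w d k :
  dotER (w + k *: d) (w + k *: d) =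
  dotER w w + 2 * k * dotER w d + k ^+ 2 * dotER d d.
Proof.
by rewrite /dotER /= -[(k *: d.2 : R^o)]/(k * d.2) sqr_dotpD; ring.
Qed.

Lemma dotER_ge0 a : 0 <= dotER a a.
Proof. by rewrite addr_ge0 ?dotp_ge0// -expr2 sqr_ge0. Qed.

Lemma normER_le a b : (normER a <= normER b) = (dotER a a <= dotER b b).
Proof. by rewrite /normER ler_sqrt// dotER_ge0. Qed.

(** Already [e = 1] works: |w + (a - b)|^2 exceeds |w|^2 by 2 w.(a - b) + |a - b|^2 >= 0. *)
Lemma prox_normal_support (S : set (ER R n)) a w : S a ->
  (forall b, S b -> dotER w b <= dotER w a) -> prox_normal S a w.
Proof.
move=> Sa wS; exists 1 => //; split=> // b Sb; rewrite normER_le scale1r.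
have -> : a + w - a = w by rewrite addrC addKr.
have -> : a + w - b = w + 1 *: (a - b) by rewrite scale1r [a + w]addrC -addrA.
rewrite sqr_dotERD dotERBr; have := dotER_ge0 (a - b); have := wS b Sb; lra.
Qed.

(** If w.(b - a) were positive, a short move from [a] toward [b] would come closer to
    [a + e *: w]. *)
Lemma prox_normal_le0 (S : set (ER R n)) a b w : prox_normal S a w ->
  (forall s, 0 < s <= 1 -> S (a + s *: (b - a))) -> dotER w (b - a) <= 0.
Proof.
case=> e e0 [_ near_a] Sab; rewrite leNgt; apply/negP => wd0.
set d := b - a in Sab wd0.
pose m := e * dotER w d; have m0 : 0 < m by rewrite mulr_gt0.
have dd := dotER_ge0 d.
(* This choice gives both [s <= 1] and [s * dotER d d <= m], so the linear gain [2 * s * m] beats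
   the quadratic loss. *)
pose s := m / (m + dotER d d).
have D0 : 0 < m + dotER d d by rewrite ltr_wpDr.
have s01 : 0 < s <= 1.
  by rewrite divr_gt0//= ler_pdivrMr// mul1r lerDl.
have /andP[s0 _] := s01.
have := near_a _ (Sab s s01); rewrite normER_le.
have -> : a + e *: w - a = e *: w by rewrite addrC addKr.
have -> : a + e *: w - (a + s *: d) = e *: w + (- s) *: d.
  by rewrite scaleNr opprD addrACA subrr add0r.
rewrite sqr_dotERD.
have -> : dotER (e *: w) d = e * dotER w d.
  by rewrite /dotER /= dotpZl -[(e *: w.2 : R^o)]/(e * w.2); ring.
suff : s * (s * dotER d d) < 2 * (s * m) by rewrite /m; lra.
rewrite [ltRHS]mulrCA ltr_pM2l//.
have : s * dotER d d <= m.
  by rewrite /s mulrAC ler_pdivrMr// ler_pM2l// lerDr ltW.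
lra.
Qed.

End InnerProduct.

(** * Segments and limits in the hypograph *)

Section Hypograph.
Context {R : realType} {n : nat}.
Variable f : 'rV[R]_n -> \bar R.
Implicit Types (x y : 'rV[R]_n) (a b w : ER R n).

Lemma hypo_conv a b (s : R) : concave f -> hypo f a -> hypo f b ->
  0 <= s <= 1 -> hypo f (a + s *: (b - a)).
Proof.
move=> cf fa fb s01.
have /andP[s0 s1] := s01.
have := cf b a (Itv01 s0 s1); rewrite !inE => /(_ fb fa).
rewrite /conv/= /unstable.onem scalerBr scalerBl scale1r.
by congr (hypo f _); rewrite addrCA addrA.
Qed.

(** Upper semicontinuity gives closedness only relative to u > 0. Staying above a positive height
    makes it absolute, as compactness and limit arguments require. *)
Lemma closed_hypo_slice (eta : R) : upper_semicont f -> 0 < eta ->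
  closed (hypo f `&` [set a | eta <= a.2]).
Proof.
move=> /closed_subspaceP[V clV VE] eta0.
have -> : hypo f `&` [set a | eta <= a.2] = V `&` [set a | eta <= a.2].
  apply/seteqP; split=> a [ha /= ea]; split=> //.
    have : (hypo f `&` [set a | 0 < a.2]) a by split=> //; case: ha.
    by rewrite -VE => -[].
  have : (V `&` [set a | 0 < a.2]) a by split=> //=; apply: lt_le_trans ea.
  by rewrite VE => -[].
apply: closedI => //.
apply: (@closed_comp _ _ (fun a : ER R n => a.2 : R) [set t | eta <= t]).
  by move=> a _; exact: cvg_snd.
exact: closed_ge.
Qed.

(** Gamma maps the ray of points (s y, s) to the vertical line over [y]. The limit is taken inside
    the slice above height [t / 2]. *)
Lemma hypo_ray_closed y (t : R) : upper_semicont f -> 0 < t ->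
  (forall s, 0 < s < t -> hypo f (s *: y, s)) -> hypo f (t *: y, t).
Proof.
move=> uf t0 fy.
have h2 : 0 < t / 2 by rewrite divr_gt0.
suff [] : (hypo f `&` [set a | t / 2 <= a.2]) (t *: y, t) by [].
apply: (@closed_cvg _ _ (t^'-) _ (fun s : R => (s *: y, s) : ER R n)).
- exact: closed_hypo_slice.
- near=> s.
  have s_t2 : t / 2 < s by near: s; apply: nbhs_left_gt; lra.
  have s_t : s < t by near: s; exact: nbhs_left_lt.
  by split; [apply: fy; rewrite s_t andbT; lra | exact: ltW].
- have st : s @[s --> t^'-] --> t by apply: cvg_at_left_filter; exact: cvg_id.
  exact: cvg_pair (cvgZr_tmp st) st.
Unshelve. all: by end_near. Qed.

End Hypograph.

(** * A positive radius forces f(0) > 0 *)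

Section RadialDual.
Context {R : realType} {n : nat}.
Variable f : 'rV[R]_n -> \bar R.
Implicit Types (x y : 'rV[R]_n) (a b w : ER R n).

Lemma norm2_continuous : continuous (@norm2 R n).
Proof.
move=> x; apply: (@continuous_comp _ _ _ (fun z => dotp z z) Num.sqrt).
  apply: continuous_big => [|i _]; first exact: add_continuous.
  have ci := @coord_continuous R 1 n ord0 i.
  by move=> z; exact: cvgM (ci z) (ci z).
exact: sqrt_continuous.
Qed.

(** Reduces upper bounds on [Rf] to a supporting hyperplane of [hypo f] and a point where it cuts u
    = 0. *)
Lemma Rf_le_norm2 a w x' : hypo f a -> w != 0 ->
  (forall b, hypo f b -> dotER w b <= dotER w a) ->
  dotER w ((x', 0) - a) = 0 -> (Rf f <= (norm2 x')%:E)%E.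
Proof.
move=> fa w0 wf wx'; apply: ereal_inf_lbound; exists x' => //.
by exists a, w; split=> //; exact: prox_normal_support.
Qed.

(* [a] is where the cone [norm2 x + rho <= m * u] with the least possible [m]
   touches [hypo f]. *)
Lemma hypo_cone_tangent (p rho : R) xs : upper_semicont f ->
  (forall x, (f x <= p%:E)%E) -> hypo f (xs, p) -> 0 < rho ->
  exists2 a, hypo f a & forall b, hypo f b ->
    b.2 / (norm2 b.1 + rho) <= a.2 / (norm2 a.1 + rho).
Proof.
move=> uf fp fxs rho0.
have p0 : 0 < p by case: fxs.
pose g (a : ER R n) := a.2 / (norm2 a.1 + rho).
have den0 x : 0 < norm2 x + rho by rewrite ltr_wpDl ?norm2_ge0.
pose v0 := g (xs, p).
have v00 : 0 < v0 by rewrite divr_gt0//.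
(* Points of [hypo f] below height [eta], or of norm beyond [M], have ratio at most [v0], the ratio
   at [(xs, p)]. So the maximum may be sought in the compact set [A]. *)
pose eta := v0 * rho.
have eta0 : 0 < eta by rewrite mulr_gt0.
pose M := norm2 xs + rho.
pose B : set (ER R n) :=
  [set x : 'rV[R]_n | forall i, `[-M, M]%classic (x ord0 i)] `*` `[eta, p]%classic.
pose A := B `&` (hypo f `&` [set a | eta <= a.2]).
have cA : compact A.
  apply: compact_closedI; last exact: closed_hypo_slice.
  apply: compact_setX; last exact: segment_compact.
  by apply: (@rV_compact _ _ (fun=> `[-M, M]%classic)) => _; exact: segment_compact.
have inA b : hypo f b -> eta <= b.2 -> norm2 b.1 <= M -> A b.
  move=> fb etab bM; split=> //; split=> /=.
    move=> i; rewrite in_itv/= -ler_norml; exact: le_trans (norm_coord_le _ _) bM.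
  by rewrite in_itv/= etab -lee_fin; case: fb => _ /le_trans; apply.
have Axs : A (xs, p).
  apply: inA => //=; last by rewrite lerDl ltW.
  by rewrite /eta/v0/g/= mulrAC ler_pdivrMr// ler_pM2l// lerDr norm2_ge0.
have gcont : {within A, continuous g}.
  apply: continuous_subspaceT => b; apply: cvgM; first exact: cvg_snd.
  apply: cvgV; first by rewrite gt_eqF.
  apply: cvgD; last exact: cvg_cst.
  by apply: continuous_comp; [exact: cvg_fst | exact: norm2_continuous].
have [a] := compact_EVT_max (ex_intro _ _ Axs) cA gcont.
rewrite inE => -[_ [fa _]] amax; exists a => // b fb; rewrite -![_ / _]/(g _).
have v0a : v0 <= g a by apply: amax; rewrite inE.
have [etab|betab] := leP eta b.2; last first.
  apply: le_trans v0a; rewrite ler_pdivrMr//.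
  by rewrite (le_trans (ltW betab))// ler_pM2l// lerDr norm2_ge0.
have [bM|Mb] := leP (norm2 b.1) M; first by apply: amax; rewrite inE; exact: inA.
apply: le_trans v0a; rewrite ler_pdivrMr//.
have bp : b.2 <= p by rewrite -lee_fin; case: fb => _ /le_trans; apply.
rewrite (le_trans bp)// /v0/g/= mulrAC ler_pdivlMr// ler_pM2l//.
by rewrite -/M; lra.
Qed.

Lemma radius_gt0_origin (p : R) xs : upper_semicont f -> concave f ->
  (forall x, (f x <= p%:E)%E) -> hypo f (xs, p) -> (0 < Rf f)%E ->
  (0 < f 0)%E.
Proof.
move=> uf cf fp fxs; apply: contraTT; rewrite -!leNgt => f0.
apply/lee_addgt0Pr => rho rho0; rewrite add0e.
have [a fa amax] := hypo_cone_tangent uf fp fxs rho0.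
have a2 : 0 < a.2 by case: fa.
have den0 x : 0 < norm2 x + rho by rewrite ltr_wpDl ?norm2_ge0.
pose N := norm2 a.1.
(* [f 0 <= 0] keeps [a] off the vertical axis, so the cone is smooth at [a]. *)
have N0 : 0 < N.
  rewrite norm2_gt0; apply/eqP => a10; case: fa => _.
  by rewrite a10 => /le_trans /(_ f0); rewrite lee_fin leNgt a2.
pose m := (N + rho) / a.2.
have ma : m * a.2 = N + rho by rewrite /m mulfVK// gt_eqF.
have m0 : 0 < m by rewrite divr_gt0// den0.
have cone b : hypo f b -> m * b.2 <= norm2 b.1 + rho.
  move=> /amax; rewrite ler_pdivrMr// mulrAC ler_pdivlMr// => bm.
  by rewrite /m mulrAC ler_pdivrMr// mulrC [leRHS]mulrC.
(* [N] times the gradient of m u - |x| at [a]. *)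
pose w : ER R n := (- a.1, N * m).
have wa : dotER w a = N * rho.
  by rewrite /dotER /= dotpNl -sqr_norm2 -/N -mulrA ma; ring.
(* The tangent hyperplane w.(x, u) = N rho meets u = 0 at this multiple of [a.1], on the opposite
   side of the origin. *)
have ax' : norm2 ((- rho / N) *: a.1) = rho.
  rewrite norm2Z -/N normrM normfV [`|N|]gtr0_norm// normrN gtr0_norm//.
  by rewrite mulfVK// gt_eqF.
rewrite -ax'; apply: (@Rf_le_norm2 a w) => //.
- apply/eqP => -[_ /eqP]; rewrite mulf_eq0 !gt_eqF//.
(* A point [b] strictly beyond the tangent hyperplane would make points of the segment from [a]
   violate [cone]: squaring that inequality at [a + s *: d] leaves 2 gap <= s |d.1|^2. The bound
   [s1] keeps the squared side nonnegative, and [s2] makes s |d.1|^2 <= gap. *)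
- move=> b fb; rewrite wa leNgt; apply/negP => wb.
  pose d := b - a; pose k := m * d.2.
  pose gap := N * k - dotp a.1 d.1.
  have gap0 : 0 < gap.
    have -> : gap = dotER w d by rewrite /gap /dotER dotpNl /k mulrA addrC.
    by rewrite dotERBr wa subr_gt0.
  have Dd := dotp_ge0 d.1.
  pose s1 := N / (N + `|k|); pose s2 := gap / (gap + dotp d.1 d.1).
  have K0 : 0 < N + `|k| by rewrite ltr_wpDr.
  have G0 : 0 < gap + dotp d.1 d.1 by rewrite ltr_wpDr.
  have s10 : 0 < s1 by rewrite divr_gt0.
  have s20 : 0 < s2 by rewrite divr_gt0.
  have s11 : s1 <= 1 by rewrite ler_pdivrMr// mul1r lerDl.
  have s1k : s1 * `|k| <= N.
    by rewrite /s1 mulrAC ler_pdivrMr// ler_pM2l// lerDr ltW.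
  have s2d : s2 * dotp d.1 d.1 <= gap.
    by rewrite /s2 mulrAC ler_pdivrMr// ler_pM2l// lerDr ltW.
  pose s := Num.min s1 s2.
  have s0 : 0 < s by rewrite lt_min s10.
  have ss1 : s <= s1 by rewrite ge_min lexx.
  have ss2 : s <= s2 by rewrite ge_min lexx orbT.
  have := cone _ (hypo_conv cf fa fb (_ : 0 <= s <= 1)).
  rewrite (ltW s0) (le_trans ss1 s11) => /(_ isT) /=.
  rewrite -/d -[(s *: d.2 : R^o)]/(s * d.2) mulrDr ma => sN.
  have Nk0 : 0 <= N + s * k.
    have : s * `|k| <= N by apply: le_trans s1k; rewrite ler_wpM2r.
    have : - (s * k) <= s * `|k| by rewrite -mulrN ler_pM2l// -normrN ler_norm.
    lra.
  have : (N + s * k) ^+ 2 <= norm2 (a.1 + s *: d.1) ^+ 2.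
    rewrite ler_pXn2r// ?nnegrE ?norm2_ge0//; rewrite /k; lra.
  rewrite sqr_norm2 sqr_dotpD -sqr_norm2 -/N => sq.
  have : s * (2 * gap) <= s * (s * dotp d.1 d.1).
    by have := sqr_ge0 (s * k); rewrite /gap; lra.
  rewrite ler_pM2l// => g2.
  have : s * dotp d.1 d.1 <= gap by apply: le_trans s2d; rewrite ler_wpM2r.
  lra.
- rewrite dotERBr wa /dotER /= dotpNl dotpZr -sqr_norm2 -/N.
  by field; rewrite gt_eqF.
Qed.

End RadialDual.

(** * Cauchy-Schwarz, the triangle inequality and one Polyak step *)

Section Norm.
Context {R : realType} {n : nat}.
Implicit Types x y z : 'rV[R]_n.

(** Expand the square of |y| x - |x| y, then divide by |x| |y|. *)
Lemma dotp_le_norm2 x y : dotp x y <= norm2 x * norm2 y.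
Proof.
have [->|x0] := eqVneq x 0.
  by rewrite -(scale0r 0) dotpZl mul0r mulr_ge0 ?norm2_ge0.
have [->|y0] := eqVneq y 0.
  by rewrite -(scale0r 0) dotpZr mul0r mulr_ge0 ?norm2_ge0.
have xy0 : 0 < norm2 x * norm2 y by rewrite mulr_gt0 ?norm2_gt0.
have := dotp_ge0 (norm2 y *: x + (- norm2 x) *: y).
rewrite sqr_dotpD !dotpE -!sqr_norm2 => h.
rewrite -(ler_pM2l xy0); nra.
Qed.

Lemma norm2D_le x y : norm2 (x + y) <= norm2 x + norm2 y.
Proof.
rewrite -(@ler_pXn2r _ 2)// ?nnegrE ?addr_ge0 ?norm2_ge0//.
rewrite sqr_norm2 -[y]scale1r sqr_dotpD scale1r sqrrD !sqr_norm2.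
by have := dotp_le_norm2 x y; rewrite mulr2n; lra.
Qed.

(** With q = delta / |z|^2, the square changes by -2 q z.(x - xs) + q delta <= -q delta, and q delta
    >= (r delta)^2 because r |z| <= 1. *)
Lemma polyak_step_decrease x xs z (delta r : R) : 0 <= r -> 0 <= delta ->
  delta <= dotp z (x - xs) -> r * norm2 z <= 1 ->
  norm2 (x - (delta / norm2 z ^+ 2) *: z - xs) ^+ 2 <=
  norm2 (x - xs) ^+ 2 - (r * delta) ^+ 2.
Proof.
move=> r0 delta0 delta_le rz.
(* A zero subgradient forces [delta = 0], so the null step loses nothing. *)
have [z0|z0] := eqVneq z 0.
  have -> : delta = 0.
    apply/le_anti; rewrite delta0 andbT (le_trans delta_le)// z0.
    by rewrite -(scale0r 0) dotpZl mul0r.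
  by rewrite z0 scaler0 subr0 mulr0 expr0n subr0.
have N0 : 0 < norm2 z by rewrite norm2_gt0.
rewrite addrAC -scaleNr !sqr_norm2 sqr_dotpD -(sqr_norm2 z) [dotp _ z]dotpC.
set q := delta / norm2 z ^+ 2.
have qz : q * norm2 z ^+ 2 = delta by rewrite mulfVK// expf_neq0// gt_eqF.
have q0 : 0 <= q by rewrite divr_ge0// sqr_ge0.
have -> : (- q) ^+ 2 * norm2 z ^+ 2 = q * delta by rewrite -qz; ring.
have : (r * delta) ^+ 2 <= q * delta.
  have -> : (r * delta) ^+ 2 = (r * norm2 z) ^+ 2 * (q * delta).
    by rewrite -qz; ring.
  have qd0 : 0 <= q * delta by apply: mulr_ge0.
  by rewrite ler_piMl// exprn_ile1// mulr_ge0// ltW.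
have : q * delta <= q * dotp z (x - xs) by rewrite ler_wpM2l.
lra.
Qed.

End Norm.

(** * The radial dual: epigraph, subgradients, infimum and sharpness *)

Section Subgradient.
Context {R : realType} {n : nat}.
Variable f : 'rV[R]_n -> \bar R.
Implicit Types (x y z : 'rV[R]_n) (a b w : ER R n) (v : R).

Lemma Gam_epi y v : 0 < v ->
  (@Gam R n @` epi f) (y, v) <-> (f (v^-1 *: y) <= (v^-1)%:E)%E.
Proof.
move=> v0; split=> [[[x u] [/= u0 fx] [<- <-]]|fy].
  by rewrite invrK scalerA divff ?gt_eqF// scale1r.
exists (v^-1 *: y, v^-1); first by split=> //=; rewrite invr_gt0.
by rewrite /Gam/= invrK scalerA divff ?gt_eqF// scale1r.
Qed.

Lemma radial_dual_ge0 y : (0 <= radial_dual f y)%E.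
Proof. by apply: ereal_sup_ubound; left. Qed.

Lemma le_radial_dual y v : 0 < v -> (f (v^-1 *: y) <= (v^-1)%:E)%E ->
  (v%:E <= radial_dual f y)%E.
Proof.
move=> v0 fy; apply: ereal_sup_ubound; right; exists v => //; split=> //.
exact/Gam_epi.
Qed.

(* Moving from [(y / v, 1 / v)] toward [(0, u)] with [f 0 >= u > 0] makes
   [v * f (y / v)] strictly increasing in [v]. *)
Lemma radial_dual_le y v : upper_semicont f -> concave f -> (0 < f 0)%E ->
  0 < v -> (radial_dual f y <= v%:E)%E <-> hypo f (v^-1 *: y, v^-1).
Proof.
move=> uf cf f0 v0; split=> [Fv|fy].
  apply: hypo_ray_closed => //; first by rewrite invr_gt0.
  move=> s /andP[s0 sv]; split=> //=; rewrite leNgt; apply/negP => fs.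
  have := le_trans (@le_radial_dual y s^-1 _ _) Fv.
  rewrite invr_gt0 invrK => /(_ s0 (ltW fs)); rewrite lee_fin leNgt => /negP; apply.
  by rewrite -[v]invrK ltf_pV2// posrE ?invr_gt0.
apply/ereal_supP => _ [->|[t [t0 /(Gam_epi _ t0) ft] <-]].
  by rewrite lee_fin ltW.
rewrite lee_fin leNgt; apply/negP => vt.
have [u u0 fu] : exists2 u : R, 0 < u & (u%:E <= f 0)%E.
  case: (f 0) f0 => [u||] //; first by rewrite lte_fin; exists u.
  by exists 1; rewrite ?leey.
(* This weight puts the first coordinate at y / t, at height 1 / t + s u, which contradicts f(y / t)
   <= 1 / t. *)
pose s := 1 - v / t.
have vt1 : v / t < 1 by rewrite ltr_pdivrMr// mul1r.
have s0 : 0 < s by rewrite subr_gt0.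
have s1 : s <= 1 by rewrite lerBlDr lerDl divr_ge0// ltW.
have := hypo_conv cf fy (conj u0 fu : hypo f (0, u)) (_ : 0 <= s <= 1).
rewrite (ltW s0) s1 => /(_ isT) [_ /=].
have -> : v^-1 *: y + s *: (0 - v^-1 *: y) = t^-1 *: y.
  rewrite sub0r scalerN scalerA -scalerBl; congr (_ *: _).
  by rewrite /s; field; rewrite !gt_eqF.
move=> /le_trans /(_ ft); rewrite lee_fin -[(s *: _ : R^o)]/(s * (u - v^-1)).
have -> : v^-1 + s * (u - v^-1) = t^-1 + s * u.
  by rewrite /s; field; rewrite !gt_eqF.
by rewrite gerDl leNgt mulr_gt0.
Qed.

(** The gap equals p / f(x) - 1, which decreases in f(x). *)
Lemma rel_gap_le (p : R) x v : 0 < v -> (f x <= p%:E)%E ->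
  hypo f (x, v^-1) -> (rel_gap f p x <= (p * v - 1)%:E)%E.
Proof.
move=> v0 + [/= vi0]; rewrite /rel_gap; case: (f x) => [t||] //.
rewrite !lee_fin => tp vt.
have t0 : 0 < t by apply: lt_le_trans vt.
rewrite inver gt_eqF// -EFinB -EFinM lee_fin mulrBl divff ?gt_eqF// lerD2r.
by rewrite ler_wpM2l ?(le_trans (ltW t0))// -[v]invrK lef_pV2// posrE.
Qed.

Section Dual.
Hypotheses (uf : upper_semicont f) (cf : concave f) (f0 : (0 < f 0)%E).

Lemma epi_radial_dual y v :
  epi (radial_dual f) (y, v) <-> 0 < v /\ hypo f (v^-1 *: y, v^-1).
Proof.
split=> [[/= v0 Fv]|[v0 fv]]; split=> //=; exact/(radial_dual_le _ uf cf f0 v0).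
Qed.

(** The last clause is the global subgradient inequality at the point Gamma(x, u) of the epigraph,
    multiplied by u. *)
Lemma prox_subdiff_radial_dual y z (V := fine (radial_dual f y)) :
  prox_subdiff (radial_dual f) y z ->
  [/\ 0 < V, radial_dual f y = V%:E, hypo f (V^-1 *: y, V^-1) &
    forall x (u : R), hypo f (x, u) -> dotp z x - 1 <= (dotp z y - V) * u].
Proof.
move=> zP; have [_ _ [yV _]] := zP.
have [V0 fV] : 0 < V /\ hypo f (V^-1 *: y, V^-1) by exact/epi_radial_dual.
split=> //.
  rewrite fineK//; move: yV (radial_dual_ge0 y) => [_] /=.
  by case: (radial_dual f y).
move=> x u fxu; have u0 : 0 < u by case: fxu.
pose b : ER R n := (u^-1 *: x, u^-1).
have := @prox_normal_le0 _ _ _ (y, V) b (z, -1) zP.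
have seg s : 0 < s <= 1 -> epi (radial_dual f) ((y, V) + s *: (b - (y, V))).
  move=> /andP[s0 s1].
  have [v vE] : {v | v = V + s * (u^-1 - V)} by eexists.
  have uvE : u * v = (1 - s) * V * u + s by rewrite vE; field; rewrite gt_eqF.
  have r0 : 0 <= (1 - s) * V * u.
    by rewrite mulr_ge0 ?(ltW u0)// mulr_ge0 ?(ltW V0)// subr_ge0.
  have v0 : 0 < v by rewrite -(pmulr_rgt0 _ u0) uvE ltr_wpDl.
  (* Gamma is projective: it carries segments to segments but changes the parameter, from [s] to
     this [t]. *)
  have [t tE] : {t | t = s / (u * v)} by eexists.
  have t1E : (1 - t) / V = (1 - s) / v.
    have -> : 1 - t = (1 - s) * V * u / (u * v).
      rewrite -(addrK s ((1 - s) * V * u)) -uvE mulrBl divff ?tE//.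
      by rewrite mulf_neq0 ?gt_eqF.
    by field; rewrite !gt_eqF.
  have t01 : 0 <= t <= 1.
    rewrite tE divr_ge0 ?mulr_ge0 ?(ltW s0) ?(ltW u0) ?(ltW v0)//=.
    by rewrite ler_pdivrMr ?mulr_gt0// mul1r uvE lerDr.
  have -> : (y, V) + s *: (b - (y, V)) = (y + s *: (u^-1 *: x - y), v) :> ER R n.
    by rewrite vE.
  apply/epi_radial_dual; split=> //.
  have := hypo_conv cf fV fxu t01.
  have -> : (V^-1 *: y, V^-1) + t *: ((x, u) - (V^-1 *: y, V^-1)) =
      (v^-1 *: (y + s *: (u^-1 *: x - y)), v^-1) :> ER R n.
    congr pair; rewrite /=.
      apply/rowP => i; rewrite !mxE.
      have -> (a' b' : R) : a' + t * (b' - a') = (1 - t) * a' + t * b' by ring.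
      by rewrite mulrA t1E tE; field; rewrite !gt_eqF.
    rewrite -[(t *: _ : R^o)]/(t * (u - V^-1)).
    have -> : V^-1 + t * (u - V^-1) = (1 - t) / V + t * u by ring.
    by rewrite t1E tE; field; rewrite !gt_eqF.
  exact.
move=> /(_ seg); rewrite dotERBr /dotER /b /= dotpZr => zle.
rewrite -ler_pdivrMr// mulrBl mul1r mulrC; lra.
Qed.

(** The subgradient inequality reads w.(x, u) <= 1 on [hypo f], with equality at [a]. The hyperplane
    cuts u = 0 in z.x = 1, whose point nearest the origin is z / |z|^2. *)
Lemma norm2_subgradient_le y z : prox_subdiff (radial_dual f) y z ->
  z != 0 -> (Rf f <= ((norm2 z)^-1)%:E)%E.
Proof.
move=> zP z0; have [V0 _ fV zle] := prox_subdiff_radial_dual zP.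
set V := fine _ in V0 fV zle.
pose a : ER R n := (V^-1 *: y, V^-1).
pose w : ER R n := (z, V - dotp z y).
have N0 : 0 < norm2 z by rewrite norm2_gt0.
have wa : dotER w a = 1.
  by rewrite /dotER /= dotpZr; field; rewrite gt_eqF.
have <- : norm2 ((norm2 z ^+ 2)^-1 *: z) = (norm2 z)^-1.
  rewrite norm2Z ger0_norm ?invr_ge0 ?sqr_ge0//; field; rewrite gt_eqF//.
apply: (@Rf_le_norm2 _ _ f a w) => //.
- by apply: contra z0 => /eqP[->].
- by move=> [x u] /zle; rewrite wa /dotER /=; lra.
- rewrite dotERBr wa /dotER /= dotpZr -sqr_norm2 mulr0 addr0 mulVf ?subrr//.
  by rewrite expf_neq0// gt_eqF.
Qed.

(** [f <= p] makes 1 / p admissible in the supremum at every [y], and the value at xs / p is no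
    larger because [(xs, p)] is in [hypo f]. *)
Lemma ereal_inf_radial_dual (p : R) xs : (forall x, (f x <= p%:E)%E) ->
  hypo f (xs, p) -> ereal_inf (range (radial_dual f)) = (p^-1)%:E.
Proof.
move=> fp fxs; have p0 : 0 < p by case: fxs.
apply/le_anti/andP; split.
  apply: le_trans (ereal_inf_lbound _) _; first by exists (p^-1 *: xs).
  apply/radial_dual_le; rewrite ?invr_gt0// invrK scalerA divff ?gt_eqF//.
  by rewrite scale1r.
apply/ereal_infP => _ [y _ <-].
by apply: le_radial_dual; rewrite ?invr_gt0// invrK.
Qed.

End Dual.

(** Growth at y / v, times v, gives C |y - v xs| <= p (v - 1 / p). The triangle inequality then
    replaces v xs by xs / p. *)
Lemma radial_dual_sharp (p C : R) xs y v : 0 < p -> 0 < C ->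
  (forall x, (f x <= maxe (p%:E - (C * norm2 (x - xs))%:E) 0)%E) ->
  0 < v -> p^-1 <= v -> hypo f (v^-1 *: y, v^-1) ->
  C * norm2 (y - p^-1 *: xs) <= (p + C * norm2 xs) * (v - p^-1).
Proof.
move=> p0 C0 growth v0 pv [/= vi0 fv].
have := le_trans fv (growth _).
rewrite le_max !lee_fin => /orP[vle|]; last by rewrite leNgt vi0.
have -> : y - p^-1 *: xs = v *: (v^-1 *: y - xs) + (v - p^-1) *: xs.
  by rewrite scalerBr scalerA divff ?gt_eqF// scale1r scalerBl addrA subrK.
have h1 := norm2D_le (v *: (v^-1 *: y - xs)) ((v - p^-1) *: xs).
apply: le_trans (ler_wpM2l (ltW C0) h1) _.
rewrite !norm2Z (gtr0_norm v0) ger0_norm ?subr_ge0//.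
have := ler_wpM2l (ltW v0) vle; rewrite divff ?gt_eqF//.
have pp : p * p^-1 = 1 by rewrite divff ?gt_eqF.
lra.
Qed.

End Subgradient.

(** * Convergence of the method under sharp growth *)

Theorem theorem2 (R : realType) (n : nat) (f : 'rV[R]_n -> \bar R)
    (p C : R) (xs : 'rV[R]_n)
    (f_ge0 : forall x, (0 <= f x)%E)
    (f_usc : upper_semicont f)
    (f_concave : concave f)
    (Rf_gt0 : (0 < Rf f)%E)
    (p_gt0 : 0 < p)
    (p_sup : ereal_sup (range f) = p%:E)
    (p_attained : f xs = p%:E)
    (C_gt0 : 0 < C)
    (sharp_growth : forall x,
      (f x <= maxe (f xs - (C * norm2 (x - xs))%:E) 0)%E)
    (T : nat) (x0 : 'rV[R]_n) (alpha : nat -> R) (y zeta : nat -> 'rV[R]_n)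
    (method : radial_subgradient_method f T x0 alpha y zeta)
    (alpha_polyak : forall k, (k < T)%N ->
      alpha k = polyak_step f (y k) (zeta k)) :
  forall eps : R, 0 < eps ->
    (0 < T)%N ->
    ((eps%:E < rel_gap f p x0)%E ->
      (2%:E * kappa p C xs (Rf f) ^+ 2 <= T%:R%:E)%E) ->
    (4%:E * kappa p C xs (Rf f) ^+ 2 * log2e (rel_gap f p x0 / eps%:E)
      <= T%:R%:E)%E ->
    (\big[mine/+oo]_(k < T) rel_gap f p (primal_point f (y k)) <= eps%:E)%E.
Proof.
move=> eps eps0 T0 T2 T4.
have fp x : (f x <= p%:E)%E by rewrite -p_sup; apply: ereal_sup_ubound; exists x.
have fxs : hypo f (xs, p) by split=> //=; rewrite p_attained.
have f0 := radius_gt0_origin f_usc f_concave fp fxs Rf_gt0.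
have [x0f y0E iter] := method.
pose V k := fine (radial_dual f (y k)).
pose delta k := V k - p^-1.
pose ystar := p^-1 *: xs.
have sub k (kT : (k < T)%N) :=
  prox_subdiff_radial_dual f_usc f_concave f0 (iter k kT).1.
have delta_ge0 k : (k < T)%N -> 0 <= delta k.
  move=> kT; have [V0 VE _ _] := sub k kT; rewrite subr_ge0 -lee_fin -VE.
  by apply: le_radial_dual; rewrite ?invr_gt0// invrK.
(* The subgradient inequality at Gamma(xs, p) = (ystar, 1 / p). *)
have delta_le k : (k < T)%N -> delta k <= dotp (zeta k) (y k - ystar).
  move=> kT; have [V0 _ _ /(_ _ _ fxs)] := sub k kT.
  rewrite -/(V k) -ler_pdivrMr// mulrBl mul1r mulrC dotpDr dotpNr dotpZr.
  by rewrite /delta; lra.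
have step k : (k < T)%N ->
    y k.+1 = y k - (delta k / norm2 (zeta k) ^+ 2) *: zeta k.
  move=> kT; rewrite (iter k kT).2 alpha_polyak// /polyak_step.
  by rewrite (ereal_inf_radial_dual f_usc f_concave f0 fp fxs).
have gap_le k : (k < T)%N ->
    (rel_gap f p (primal_point f (y k)) <= (p * delta k)%:E)%E.
  move=> kT; have [V0 _ fV _] := sub k kT.
  rewrite /delta mulrBr divff ?gt_eqF//; exact: rel_gap_le.
suff [k kT dk] : exists2 k, (k < T)%N & p * delta k <= eps.
  apply: (bigmin_inf (Ordinal kT)) => //.
  by apply: le_trans (gap_le k kT) _; rewrite lee_fin.
(* An infinite radius leaves only the zero subgradient, so [y 0] is already a minimizer. *)
have [r_oo|] := eqVneq (Rf f) +oo%E.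
  exists 0%N => //; have [z0|z0] := eqVneq (zeta 0%N) 0; last first.
    have := norm2_subgradient_le f_usc f_concave f0 (iter 0%N T0).1 z0.
    by rewrite r_oo.
  apply: le_trans (ltW eps0); rewrite pmulr_rle0//.
  by apply: le_trans (delta_le 0%N T0) _; rewrite z0 -(scale0r 0) dotpZl mul0r.
move: Rf_gt0 T2 T4 => + + +.
have sub_norm k (kT : (k < T)%N) :=
  norm2_subgradient_le f_usc f_concave f0 (iter k kT).1.
case: (Rf f) sub_norm => [r||] // sub_norm r0 T2 T4 _.
rewrite lte_fin in r0.
have rz k : (k < T)%N -> r * norm2 (zeta k) <= 1.
  move=> kT; have [->|z0] := eqVneq (zeta k) 0.
    have /eqP -> : norm2 (0 : 'rV[R]_n) == 0 by rewrite norm2_eq0.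
    by rewrite mulr0.
  have := sub_norm k kT z0; rewrite lee_fin => rle.
  by rewrite -ler_pdivlMr ?norm2_gt0// div1r.
pose t := fine (f x0).
have [ft t0] : f x0 = t%:E /\ 0 < t.
  by rewrite /t; move: x0f => /andP[]; case: (f x0) => [s||].
pose g0 := (p - t) / t.
have gE : rel_gap f p x0 = g0%:E by rewrite /rel_gap ft inver gt_eqF.
(* Gamma sends (x0, f(x0)) into the epigraph of the dual, so f^Gamma(y_0) <= 1 / f(x0). *)
have dg : p * delta 0%N <= g0.
  have : (radial_dual f (y 0%N) <= (t^-1)%:E)%E.
    apply/radial_dual_le; rewrite ?invr_gt0// y0E /= -/t invrK scalerA.
    by rewrite divff ?gt_eqF// scale1r; split=> //=; rewrite ft.
  have [_ -> _ _] := sub 0%N T0; rewrite lee_fin -/(V 0%N) => Vt.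
  rewrite /delta /g0 mulrBr mulrBl !divff ?gt_eqF// lerD2r.
  by rewrite ler_wpM2l// ltW.
have [g_eps|eps_g] := leP g0 eps; first by exists 0%N => //; exact: le_trans g_eps.
pose A := p + C * norm2 xs.
have A0 : 0 < A by rewrite ltr_pwDl// mulr_ge0 ?norm2_ge0// ltW.
have Cr0 : 0 < C * r by rewrite mulr_gt0.
pose kap := A / (C * r).
have kapE : kappa p C xs r%:E = kap%:E.
  by rewrite /kappa -EFinM inver gt_eqF.
pose G := g0 / eps.
have G1 : 1 < G by rewrite ltr_pdivlMr// mul1r.
have logE : log2e (rel_gap f p x0 / eps%:E) = (ln G / ln 2)%:E.
  rewrite gE inver gt_eqF// -EFinM /log2e lne_EFin; last by rewrite (lt_trans _ G1).
  by rewrite inver gt_eqF// ln_gt0// ltr1n.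
move: T2 T4; rewrite logE gE kapE lte_fin -!EFin_expe -!EFinM !lee_fin.
move=> /(_ eps_g) T2 T4.
(* The factor p / r turns the decrease (r delta)^2 into (p delta)^2, and sharpness into the constant
   [kap]. *)
pose D k := (p / r * norm2 (y k - ystar)) ^+ 2.
apply: (@polyak_iterations R T D (fun k => p * delta k) kap G eps) => //.
- by move=> k; exact: sqr_ge0.
- by move=> k kT; rewrite mulr_ge0 ?delta_ge0// ltW.
- move=> k kT; rewrite /D step// !exprMn.
  have := polyak_step_decrease (ltW r0) (delta_ge0 k kT) (delta_le k kT) (rz k kT).
  have pr0 : 0 <= (p / r) ^+ 2 by exact: sqr_ge0.
  move=> /(ler_wpM2l pr0); rewrite !exprMn mulrBr => /le_trans; apply.
  rewrite lerD2l lerN2 le_eqVlt; apply/orP; left; apply/eqP.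
  by field; rewrite gt_eqF.
- move=> k kT; rewrite -exprMn /D.
  have [V0 _ fV _] := sub k kT.
  have := radial_dual_sharp (xs := xs) p_gt0 C_gt0 _ V0 _ fV.
  rewrite -/(V k) -subr_ge0 -/(delta k) delta_ge0// -p_attained.
  move=> /(_ sharp_growth isT) Cd.
  rewrite ler_pXn2r// ?nnegrE; last 2 first.
  + by rewrite mulr_ge0 ?norm2_ge0// divr_ge0// ltW.
  + by rewrite mulr_ge0// ?divr_ge0 ?mulr_ge0 ?delta_ge0// ltW.
  rewrite /kap -(ler_pM2l Cr0).
  have -> : C * r * (p / r * norm2 (y k - ystar)) = p * (C * norm2 (y k - ystar)).
    by field; rewrite gt_eqF.
  have -> : C * r * (A / (C * r) * (p * delta k)) = p * (A * delta k).
    by field; rewrite !gt_eqF.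
  by rewrite ler_pM2l.
- by rewrite /G mulfVK// gt_eqF.
Qed.
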